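(* Let $X$ be a random vector in $\mathbb R^d$ ($d\ge 2$) with mean $\mu$ whose covariance matrix $\Sigma$ exists, and let $Q\in \mathrm O(d)$ be an orthogonal matrix. If $X-\mu$ and $Q(X-\mu)$ have the same distribution, then $Q\Sigma=\Sigma Q$. If, in addition, $\Sigma$ has simple spectrum with eigenpairs $(\lambda_i,u_i)$, $i=1,\dots,d$ (so that $\lambda_1>\cdots>\lambda_d\ge 0$ and $u_1,\dots,u_d$ is an orthonormal basis of $\mathbb R^d$), then for every $i$ one has $Qu_i=\epsilon_i u_i$ with $\epsilon_i\in\{-1,+1\}$; equivalently, $$Q=\sum_{i=1}^d\epsilon_i u_iu_i^\top=2\,\mathrm P_S-I_d,\qquad S=\{i:\epsilon_i=+1\},\quad \mathrm P_S=\sum_{i\in S}u_iu_i^\top .$$ In particular, $Q$ is the orthogonal reflection through the subspace $V_S=\operatorname{span}\{u_i:i\in S\}$, that is, $Q=2\,\mathrm P_{V_S}-I_d$ where $\mathrm P_{V_S}$ is the orthogonal projection onto $V_S$.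
   Context: $\mathrm O(d)$ is the group of $d\times d$ orthogonal matrices. It is assumed that $\mathbb E\|X\|^2<\infty$. For a linear subspace $V$, the orthogonal reflection through $V$ is $Q_V=2\mathrm P_V-I_d$, with $\mathrm P_V$ the orthogonal projection onto $V$. *)

(* Defs.v *)
From HB Require Import structures.
From mathcomp Require Import all_boot all_order all_algebra.
From mathcomp Require Import all_classical all_reals all_analysis.

Set Implicit Arguments.
Unset Strict Implicit.
Unset Printing Implicit Defensive.

Import Order.TTheory GRing.Theory Num.Theory.
Import numFieldNormedType.Exports.

Local Open Scope classical_set_scope.
Local Open Scope ring_scope.

(* R^d with its Borel sigma-algebra (generated by the open sets). *)
Definition borel_cV (R : realType) (d : nat) :=
  g_sigma_algebraType (@open 'cV[R]_d).

(* The norm that the library puts on matrices is the sup norm, so the Euclidean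
   structure of R^d is expressed through this inner product. *)
Definition dot (R : realType) (d : nat) (x y : 'cV[R]_d) : R :=
  (x^T *m y) 0 0.

Definition orthogonal_mx (R : realType) (d : nat) (Q : 'M[R]_d) : Prop :=
  Q^T *m Q = 1%:M.

Definition square_integrable (R : realType) (d : nat)
    (disp : measure_display) (T : measurableType disp) (P : probability T R)
    (X : T -> 'cV[R]_d) : Prop :=
  ('E_P[fun w => dot (X w) (X w)] < +oo)%E.

Definition mean_vector (R : realType) (d : nat)
    (disp : measure_display) (T : measurableType disp) (P : probability T R)
    (X : T -> 'cV[R]_d) : 'cV[R]_d :=
  \col_i fine 'E_P[fun w => (X w i 0)%R]%E.

Definition covariance_mx (R : realType) (d : nat)
    (disp : measure_display) (T : measurableType disp) (P : probability T R)
    (X : T -> 'cV[R]_d) : 'M[R]_d :=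
  \matrix_(i, j) fine (covariance P (fun w => X w i 0) (fun w => X w j 0)).

Definition same_distribution (R : realType) (d : nat)
    (disp : measure_display) (T : measurableType disp) (P : probability T R)
    (Y Z : T -> 'cV[R]_d) : Prop :=
  forall A : set (borel_cV R d), measurable A ->
    pushforward P (Y : T -> borel_cV R d) A =
    pushforward P (Z : T -> borel_cV R d) A.

Definition is_orthproj (R : realType) (d : nat) (V : {vspace 'cV[R]_d})
    (p : 'M[R]_d) : Prop :=
  forall x : 'cV[R]_d,
    p *m x \in V /\ forall v : 'cV[R]_d, v \in V -> dot v (x - p *m x) = 0.

(* The default value 0 is never used: see orthprojP. *)
Definition orthproj (R : realType) (d : nat) (V : {vspace 'cV[R]_d}) : 'M[R]_d :=
  xget 0 [set p | is_orthproj V p].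

Definition reflection (R : realType) (d : nat) (V : {vspace 'cV[R]_d}) :
    'M[R]_d :=
  2 *: orthproj V - 1%:M.

Lemma dot_eq0 (R : realType) (d : nat) (x : 'cV[R]_d) : dot x x = 0 -> x = 0.
Proof.
rewrite /dot mxE => h; apply/colP => i; rewrite mxE.
have h0 : \sum_j x j 0 ^+ 2 = 0.
  by rewrite -[RHS]h; apply: eq_bigr => j _; rewrite mxE expr2.
have /(_ i isT) /eqP := psumr_eq0P (fun j _ => sqr_ge0 (x j 0)) h0.
by rewrite sqrf_eq0 => /eqP.
Qed.

Lemma is_orthproj_uniq (R : realType) (d : nat) (V : {vspace 'cV[R]_d})
  (p q : 'M[R]_d) : is_orthproj V p -> is_orthproj V q -> p = q.
Proof.
move=> hp hq.
have e (x : 'cV[R]_d) : p *m x = q *m x.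
  have [px ph] := hp x; have [qx qh] := hq x.
  apply/eqP; rewrite -subr_eq0; apply/eqP/dot_eq0.
  have hV : p *m x - q *m x \in V by rewrite rpredB.
  have -> : dot (p *m x - q *m x) (p *m x - q *m x)
     = dot (p *m x - q *m x) (x - q *m x) - dot (p *m x - q *m x) (x - p *m x).
    have {2}-> : p *m x - q *m x = (x - q *m x) - (x - p *m x).
      by rewrite opprB [RHS]addrC addrA subrK.
    by rewrite /dot mulmxBr [LHS]mxE [X in _ + X]mxE.
  by rewrite ph // qh // subr0.
apply/matrixP => i j.
have /colP /(_ i) := e (delta_mx j 0).
by rewrite -!colE !mxE.
Qed.

Lemma is_orthproj_exists (R : realType) (d : nat) (V : {vspace 'cV[R]_d}) :
  exists p, is_orthproj V p.
Proof.
pose k := \dim V.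
pose B : 'M[R]_(d, k) := \matrix_(i, j) (vbasis V)`_j i 0.
have BE (c : 'cV[R]_k) : B *m c = \sum_j c j 0 *: (vbasis V)`_j.
  apply/colP => i; rewrite mxE summxE; apply: eq_bigr => j _.
  by rewrite !mxE mulrC.
have BV (c : 'cV[R]_k) : B *m c \in V.
  rewrite BE rpred_sum // => j _; rewrite rpredZ // vbasis_mem //.
  by rewrite mem_nth // size_tuple.
have VB v : v \in V -> exists c : 'cV[R]_k, v = B *m c.
  move=> vV; exists (\col_j coord (vbasis V) j v).
  rewrite BE {1}(coord_vbasis vV); apply: eq_bigr => j _.
  by rewrite mxE.
have Binj (c : 'cV[R]_k) : B *m c = 0 -> c = 0.
  rewrite BE => h; apply/colP => j; rewrite [RHS]mxE.
  by have /freeP := basis_free (vbasisP V); exact: (fun H => H (fun j => c j 0) h j).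
have uG : B^T *m B \in unitmx.
  rewrite -row_free_unit -kermx_eq0; apply/rowV0P => r /sub_kermxP h.
  have : r^T = 0; last by move/(congr1 trmx); rewrite trmxK trmx0.
  apply/Binj/dot_eq0.
  by rewrite /dot trmx_mul trmxK -mulmxA [B^T *m _]mulmxA mulmxA h mul0mx mxE.
exists (B *m (invmx (B^T *m B) *m B^T)) => x; split.
  by rewrite -mulmxA; exact: BV.
move=> v /VB [c ->]; rewrite /dot trmx_mul -(mulmxA c^T).
suff -> : B^T *m (x - B *m (invmx (B^T *m B) *m B^T) *m x) = 0.
  by rewrite mulmx0 mxE.
rewrite mulmxBr.
have -> : B^T *m (B *m (invmx (B^T *m B) *m B^T) *m x) =
    B^T *m B *m invmx (B^T *m B) *m (B^T *m x) by rewrite !mulmxA.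
by rewrite mulmxV // mul1mx subrr.
Qed.

Lemma orthprojP (R : realType) (d : nat) (V : {vspace 'cV[R]_d}) :
  is_orthproj V (orthproj V).
Proof.
have [p hp] := is_orthproj_exists V.
by rewrite /orthproj; apply: (@xgetPex _ 0 [set p | is_orthproj V p]); exists p.
Qed.

(* Main.v *)
Require Import Defs.
From HB Require Import structures.
From mathcomp Require Import all_boot all_order all_algebra.
From mathcomp Require Import all_classical all_reals all_analysis.
From mathcomp Require Import measurable_realfun.

Set Implicit Arguments.
Unset Strict Implicit.
Unset Printing Implicit Defensive.

Import Order.TTheory GRing.Theory Num.Theory.
Import numFieldNormedType.Exports.

Local Open Scope ring_scope.

(** Put [Z = X - mu].  The covariance matrix of [X] is the matrix of second
moments [E(Z_i Z_j)], which depends only on the law of [Z]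
([same_distribution_second_moment_mx]).  Replacing [Z] by [Q Z] conjugates it,
[E((QZ)(QZ)^T) = Q Sigma Q^T] ([second_moment_mx_mulmx]), so equality of the two
laws gives [Sigma = Q Sigma Q^T], which is [Sigma Q = Q Sigma] because
[Q^T Q = 1].

If [Sigma] is diagonal in an orthonormal basis [u] with distinct eigenvalues, a
matrix commuting with [Sigma] maps each eigenline into itself
([commute_simple_spectrum]), and an isometry scales an invariant line by [1] or
[-1] ([orthogonal_eigenvalue]).

The remaining equivalences rest on the resolution of the identity
[sum_i u_i u_i^T = 1] ([orthonormal_sum_outer]): acting diagonally on [u] is the
same as being [sum_i eps_i u_i u_i^T], and writing [eps_i = 2 [i in S] - 1] turns
this into [2 P_S - 1].  Finally [P_S] satisfies the characterization of the
orthogonal projection onto [span {u_i : i in S}] ([is_orthproj_sum_outer]), which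
determines it. *)

(** * Second moments of random vectors *)

(** Square integrability, stated coordinatewise so that the vector space
structure of L^2 and the Cauchy-Schwarz inequality apply to each entry. *)
Definition coordLfun2 (R : realType) (d : nat) (disp : measure_display)
    (T : measurableType disp) (P : probability T R) (Z : T -> 'cV[R]_d) : Prop :=
  forall i, (fun w => Z w i 0) \in Lfun P 2%:E.

Definition second_moment_mx (R : realType) (d : nat) (disp : measure_display)
    (T : measurableType disp) (P : probability T R) (Z : T -> 'cV[R]_d) :
    'M[R]_d :=
  \matrix_(i, j) fine 'E_P[fun w => (Z w i 0 * Z w j 0)%R]%E.

(** The Borel sets of R are generated by the open intervals, whose preimages
under the continuous map [x |-> x_i] are open. *)
Lemma measurable_coord (R : realType) (d : nat) (i : 'I_d) :
  measurable_fun [set: borel_cV R d] (fun x : borel_cV R d => (x : 'cV[R]_d) i 0).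
Proof.
apply: (measurability _ (RGenOpens.measurableE R)).
move=> _ [_ [a [b ->] <-]]; rewrite setTI; apply: sub_sigma_algebra.
have /continuousP co := @coord_continuous R d 1 i 0.
exact: co (interval_open _ _).
Qed.

Section moments.
Context (R : realType) (d : nat) (disp : measure_display)
        (T : measurableType disp) (P : probability T R).

(** Each square [x_i ^+ 2] is dominated by [dot x x], the sum of all of them. *)
Lemma square_integrable_coordLfun2 (X : {RV P >-> borel_cV R d}) :
  square_integrable P X -> coordLfun2 P X.
Proof.
move=> X2 i; set f := fun w => _.
have mX j : measurable_fun setT (fun w => (X w : 'cV[R]_d) j 0).
  exact: measurableT_comp (@measurable_coord R d j) _.
have dotE w : dot (X w) (X w) = \sum_j (X w : 'cV[R]_d) j 0 ^+ 2.
  by rewrite /dot mxE; apply: eq_bigr => j _; rewrite mxE expr2.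
apply/andP; split; rewrite inE /=; first exact: mX.
rewrite /finite_norm unlock poweR_lty//; apply: le_lt_trans X2.
rewrite unlock; apply: ge0_le_integral => //.
- by move=> w _; rewrite /= lee_fin powR_ge0.
- apply/measurable_EFinP.
  apply: (@measurableT_comp _ _ _ _ _ _ (fun x : R => x `^ 2)) => //.
  by apply: measurableT_comp => //; exact: mX.
- apply/measurable_EFinP; under eq_fun do rewrite dotE.
  by apply: measurable_sum => j; apply: measurable_funX; exact: mX.
- move=> w _; rewrite /= lee_fin powR_mulrn// real_normK ?num_real// dotE.
  by rewrite (bigD1 i)//= lerDl sumr_ge0// => j _; exact: sqr_ge0.
Qed.

Lemma coordLfun2B (Z : T -> 'cV[R]_d) (c : 'cV[R]_d) :
  coordLfun2 P Z -> coordLfun2 P (fun w => Z w - c).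
Proof.
move=> Z2 i.
have -> : (fun w => (Z w - c) i 0) = (fun w => Z w i 0) - cst (c i 0).
  by apply/funext => w; rewrite !mxE.
rewrite rpredB ?lee1n// => ?.
exact: Lfun_cst.
Qed.

Lemma coordLfun2_mulmx (Q : 'M[R]_d) (Z : T -> 'cV[R]_d) :
  coordLfun2 P Z -> coordLfun2 P (fun w => Q *m Z w).
Proof.
move=> Z2 i.
have -> : (fun w => (Q *m Z w) i 0) = \sum_k Q i k *: (fun w => Z w k 0).
  by apply/funext => w; rewrite mxE fct_sumE.
by rewrite rpred_sum ?lee1n// => ? k _; rewrite rpredZ//; exact: Z2.
Qed.

Lemma coordLfun2_integrable (Z : T -> 'cV[R]_d) i j : coordLfun2 P Z ->
  P.-integrable setT (EFin \o (fun w => Z w i 0 * Z w j 0)).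
Proof.
by move=> Z2; apply/Lfun1_integrable; exact: Lfun2_mul_Lfun1 (Z2 i) (Z2 j).
Qed.

(** [(QZ)_i (QZ)_j] is the double sum of [Q_ik Q_jl Z_k Z_l]; each [Z_k Z_l] is
integrable, so the expectation passes inside the sum. *)
Lemma second_moment_mx_mulmx (Q : 'M[R]_d) (Z : T -> 'cV[R]_d) :
  coordLfun2 P Z ->
  second_moment_mx P (fun w => Q *m Z w) = Q *m second_moment_mx P Z *m Q^T.
Proof.
move=> Z2; apply/matrixP => i j; rewrite mxE.
pose F (p : 'I_d * 'I_d) w :=
  ((Q i p.1 * Q j p.2)%:E * (Z w p.1 0 * Z w p.2 0)%:E)%E.
have iF p : P.-integrable setT (F p).
  by apply: integrableZl => //; exact: coordLfun2_integrable.
have -> : 'E_P[fun w => ((Q *m Z w) i 0 * (Q *m Z w) j 0)%R]%E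
    = (\int[P]_w (\sum_p F p w))%E.
  rewrite unlock; apply: eq_integral => w _.
  rewrite !mxE big_distrlr /= pair_big /= -sumEFin; apply: eq_bigr => p _.
  by rewrite /F -EFinM mulrACA.
rewrite integral_sum// -sum_fine; last by move=> p _; exact: integrable_fin_num.
rewrite mxE; under [RHS]eq_bigr do rewrite !mxE mulr_suml.
rewrite exchange_big pair_big /=; apply: eq_bigr => p _.
rewrite /F integralZl//; last exact: coordLfun2_integrable.
rewrite fineM//; last first.
  by apply: integrable_fin_num => //; exact: coordLfun2_integrable.
by rewrite !mxE unlock mulrAC.
Qed.

(** Both expectations are integrals of the identity against the laws on R of
[f \o Y] and [f \o Z]; these laws agree because [f] pulls Borel sets back to
Borel sets. *)
Lemma same_distribution_expectation (Y Z : T -> 'cV[R]_d)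
    (f : borel_cV R d -> R) :
  same_distribution P Y Z -> measurable_fun setT f ->
  P.-integrable setT (EFin \o (f \o Y)) ->
  P.-integrable setT (EFin \o (f \o Z)) ->
  'E_P[f \o Y]%E = 'E_P[f \o Z]%E.
Proof.
move=> YZ mf iY iZ.
have mY : measurable_fun setT (f \o Y).
  by apply/measurable_EFinP; case/integrableP: iY.
have mZ : measurable_fun setT (f \o Z).
  by apply/measurable_EFinP; case/integrableP: iZ.
pose fY : {RV P >-> R} := HB.pack (f \o Y) (isMeasurableFun.Build _ _ _ _ _ mY).
pose fZ : {RV P >-> R} := HB.pack (f \o Z) (isMeasurableFun.Build _ _ _ _ _ mZ).
have mE : measurable_fun setT (@EFin R) by exact: EFin_measurable.
rewrite unlock.
have := @integral_distribution _ _ T _ R P fY EFin mE iY.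
have := @integral_distribution _ _ T _ R P fZ EFin mE iZ.
rewrite /= => <- <-; apply: eq_measure_integral => A mA _.
apply: (YZ (f @^-1` A)%classic).
by rewrite -[X in measurable X]setTI; exact: mf.
Qed.

Lemma same_distribution_second_moment_mx (Y Z : T -> 'cV[R]_d) :
  coordLfun2 P Y -> coordLfun2 P Z -> same_distribution P Y Z ->
  second_moment_mx P Y = second_moment_mx P Z.
Proof.
move=> Y2 Z2 YZ; apply/matrixP => i j; rewrite !mxE; congr fine.
pose f (x : borel_cV R d) : R := (x : 'cV[R]_d) i 0 * (x : 'cV[R]_d) j 0.
apply: (@same_distribution_expectation Y Z f) => //.
- by apply: measurable_funM; exact: measurable_coord.
- exact: coordLfun2_integrable.
- exact: coordLfun2_integrable.
Qed.

(** The library centres each coordinate by its own expectation, which is the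
corresponding entry of [mean_vector P X]. *)
Lemma covariance_mxE (X : T -> 'cV[R]_d) :
  covariance_mx P X = second_moment_mx P (fun w => X w - mean_vector P X).
Proof.
apply/matrixP => i j; rewrite !mxE unlock; congr (fine (expectation _ _)).
by apply/funext => w; rewrite !mxE.
Qed.

End moments.

(** * Matrices diagonal in an orthonormal basis *)

Section orthonormal_basis.
Context (R : realType) (d : nat) (u : 'I_d -> 'cV[R]_d)
        (uON : forall i j, dot (u i) (u j) = (i == j)%:R).

Lemma tr_mul_orthonormal i j : (u i)^T *m u j = (i == j)%:R%:M.
Proof. by rewrite [LHS]mx11_scalar -[_ 0 0]/(dot _ _) uON. Qed.

Lemma orthonormal_outer i j : u i *m (u i)^T *m u j = (i == j)%:R *: u j.
Proof.
rewrite -mulmxA tr_mul_orthonormal mul_mx_scalar.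
by case: eqVneq => [->|]; rewrite ?scale0r.
Qed.

(** With [U] the square matrix of columns [u i], orthonormality is [U^T U = 1];
a one-sided inverse of a square matrix is two-sided, and [U U^T] is the sum. *)
Lemma orthonormal_sum_outer : \sum_i u i *m (u i)^T = 1%:M.
Proof.
pose U : 'M[R]_d := \matrix_(i, j) u j i 0.
have UU : U^T *m U = 1%:M.
  apply/matrixP => i j; rewrite !mxE -uON /dot mxE.
  by apply: eq_bigr => k _; rewrite !mxE.
rewrite -(mulmx1C UU); apply/matrixP => i j; rewrite summxE !mxE.
by apply: eq_bigr => k _; rewrite !mxE big_ord1 !mxE.
Qed.

Lemma orthonormal_expand (x : 'cV[R]_d) : x = \sum_i dot (u i) x *: u i.
Proof.
rewrite -[LHS]mul1mx -orthonormal_sum_outer mulmx_suml.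
apply: eq_bigr => i _; rewrite -mulmxA [_^T *m x]mx11_scalar.
by rewrite mul_mx_scalar.
Qed.

Lemma orthonormal_diagE (A : 'M[R]_d) (a : 'I_d -> R) :
  (forall i, A *m u i = a i *: u i) <-> A = \sum_i a i *: (u i *m (u i)^T).
Proof.
split=> [Au|-> i].
  rewrite -[LHS]mulmx1 -orthonormal_sum_outer mulmx_sumr.
  by apply: eq_bigr => i _; rewrite mulmxA Au -scalemxAl.
rewrite mulmx_suml (bigD1 i)//= big1 ?addr0 => [|j ji].
  by rewrite -scalemxAl orthonormal_outer eqxx scale1r.
by rewrite -scalemxAl orthonormal_outer (negbTE ji) scale0r scaler0.
Qed.

(** [A] is a combination of the symmetric matrices [u_i u_i^T], so [u i] is also a
left eigenvector. *)
Lemma dot_diag (A : 'M[R]_d) (a : 'I_d -> R) i (x : 'cV[R]_d) :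
  (forall i, A *m u i = a i *: u i) -> dot (u i) (A *m x) = a i * dot (u i) x.
Proof.
move=> /orthonormal_diagE ->.
rewrite /dot mulmxA mulmx_sumr (bigD1 i)//= big1 ?addr0 => [|j ji].
  by rewrite -scalemxAr mulmxA tr_mul_orthonormal eqxx mul1mx -scalemxAl mxE.
rewrite -scalemxAr mulmxA tr_mul_orthonormal eq_sym (negbTE ji).
by rewrite mul_scalar_mx scale0r scaler0.
Qed.

(** Evaluating the coordinate [<u_j, A Q u_i> = <u_j, Q A u_i>] in two ways gives
[a_j <u_j, Q u_i> = a_i <u_j, Q u_i>], so only the coordinate [j = i] of [Q u_i]
can be nonzero. *)
Lemma commute_simple_spectrum (A Q : 'M[R]_d) (a : 'I_d -> R) :
  injective a -> (forall i, A *m u i = a i *: u i) -> Q *m A = A *m Q ->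
  forall i, Q *m u i = dot (u i) (Q *m u i) *: u i.
Proof.
move=> ainj Au QA i.
rewrite [LHS]orthonormal_expand (bigD1 i)//= big1 ?addr0 // => j ji.
suff -> : dot (u j) (Q *m u i) = 0 by rewrite scale0r.
have : a j * dot (u j) (Q *m u i) = a i * dot (u j) (Q *m u i).
  rewrite -(dot_diag _ _ Au) mulmxA -QA -mulmxA Au.
  by rewrite /dot -!scalemxAr mxE.
move/eqP; rewrite -subr_eq0 -mulrBl mulf_eq0 subr_eq0 => /orP[/eqP /ainj ij|/eqP//].
by rewrite ij eqxx in ji.
Qed.

(** A sign is [2 [eps = 1] - 1], and the constant [1] sums to the identity. *)
Lemma sum_sign_outer (eps : 'I_d -> R) :
  (forall i, eps i = 1 \/ eps i = -1) ->
  \sum_i eps i *: (u i *m (u i)^T) =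
    2 *: (\sum_(i in [set i | eps i == 1]%SET) u i *m (u i)^T) - 1%:M.
Proof.
move=> epsP.
rewrite -orthonormal_sum_outer [\sum_(i in _) _]big_mkcond scaler_sumr -sumrB.
apply: eq_bigr => i _; rewrite inE; case: (epsP i) => ->.
  by rewrite eqxx scale1r scaler_nat mulr2n addrK.
by rewrite eqNr oner_eq0 scaler0 sub0r scaleN1r.
Qed.

(** Write [p] for the sum.  Its range lies in the span, it is symmetric, and it
fixes every [u i] with [i \in S], hence the whole span; therefore
[<v, x - p x> = <v, x> - <p v, x> = 0] for [v] in the span. *)
Lemma is_orthproj_sum_outer (S : {set 'I_d}) :
  is_orthproj <<[seq u i | i in S]>>%VS (\sum_(i in S) u i *m (u i)^T).
Proof.
move=> x; split.
  rewrite mulmx_suml rpred_sum // => i iS.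
  rewrite -mulmxA [_^T *m x]mx11_scalar mul_mx_scalar rpredZ// memv_span//.
  exact: fintype.image_f.
pose p := \sum_(i in S) u i *m (u i)^T.
have pT : p^T = p.
  rewrite /p linear_sum; apply: eq_bigr => i _ /=.
  by rewrite trmx_mul trmxK.
have pu i : i \in S -> p *m u i = u i.
  move=> iS; rewrite mulmx_suml (bigD1 i)//= big1 ?addr0 => [|j /andP[_ ji]].
    by rewrite orthonormal_outer eqxx scale1r.
  by rewrite orthonormal_outer (negbTE ji) scale0r.
move=> v vV; suff pv : p *m v = v.
  by rewrite -/p /dot mulmxBr mulmxA -{1}pT -trmx_mul pv subrr mxE.
rewrite (coord_span (X := in_tuple [seq u i | i in S]) vV) mulmx_sumr.
apply: eq_bigr => k _; rewrite -scalemxAr; congr (_ *: _).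
have /fintype.imageP[i iS ->] :
    (in_tuple [seq u i | i in S])`_k \in [seq u i | i in S].
  by rewrite mem_nth.
exact: pu.
Qed.

End orthonormal_basis.

(** [Q] preserves the squared norm, so [c ^+ 2 = 1]. *)
Lemma orthogonal_eigenvalue (R : realType) (d : nat) (Q : 'M[R]_d)
    (x : 'cV[R]_d) (c : R) :
  orthogonal_mx Q -> dot x x = 1 -> Q *m x = c *: x -> c = 1 \/ c = -1.
Proof.
move=> QQ xx Qx.
have : dot (Q *m x) (Q *m x) = 1.
  by rewrite /dot trmx_mul -mulmxA (mulmxA Q^T) QQ mul1mx.
rewrite Qx {1}/dot -scalemxAr mxE linearZ -scalemxAl mxE -/(dot x x) xx mulr1.
rewrite -expr2 => /eqP; rewrite sqrf_eq1 => /orP[] /eqP; by [left|right].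
Qed.

Theorem proposition3p1 (R : realType) (d : nat) (hd : (2 <= d)%N)
    (disp : measure_display) (T : measurableType disp) (P : probability T R)
    (X : {RV P >-> borel_cV R d}) (hX2 : square_integrable P X)
    (mu : 'cV[R]_d) (hmu : mu = mean_vector P X)
    (Sigma : 'M[R]_d) (hSigma : Sigma = covariance_mx P X)
    (Q : 'M[R]_d) (hQ : orthogonal_mx Q)
    (hsym : same_distribution P (fun w => (X w : 'cV[R]_d) - mu)
                                (fun w => Q *m ((X w : 'cV[R]_d) - mu))) :
  Q *m Sigma = Sigma *m Q /\
  forall (lambda : 'I_d -> R) (u : 'I_d -> 'cV[R]_d),
    (forall i j : 'I_d, (i < j)%N -> lambda j < lambda i) ->
    (forall i, 0 <= lambda i) ->
    (forall i j, dot (u i) (u j) = (i == j)%:R) ->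
    (forall i, Sigma *m u i = lambda i *: u i) ->
    (exists eps : 'I_d -> R,
        (forall i, eps i = 1 \/ eps i = -1) /\
        (forall i, Q *m u i = eps i *: u i)) /\
    (forall eps : 'I_d -> R,
        (forall i, eps i = 1 \/ eps i = -1) ->
        let S : {set 'I_d} := [set i | eps i == 1]%SET in
        let P_S : 'M[R]_d := \sum_(i in S) u i *m (u i)^T in
        let V_S : {vspace 'cV[R]_d} := <<[seq u i | i in S]>>%VS in
        [/\ (forall i, Q *m u i = eps i *: u i) <->
              Q = \sum_i eps i *: (u i *m (u i)^T),
            \sum_i eps i *: (u i *m (u i)^T) = 2 *: P_S - 1%:M
          & (forall i, Q *m u i = eps i *: u i) ->
              Q = 2 *: P_S - 1%:M /\ Q = reflection V_S]).
Proof.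
have Z2 : coordLfun2 P (fun w => (X w : 'cV[R]_d) - mu).
  exact: coordLfun2B (square_integrable_coordLfun2 hX2).
(* The law of [Z = X - mu] is that of [Q Z], so their second moments agree. *)
have SigmaE : Sigma = Q *m Sigma *m Q^T.
  rewrite hSigma covariance_mxE -hmu -second_moment_mx_mulmx //.
  apply: same_distribution_second_moment_mx => //.
  exact: coordLfun2_mulmx.
have QS : Q *m Sigma = Sigma *m Q by rewrite {2}SigmaE -!mulmxA hQ mulmx1.
split=> // lambda u lamlt _ uON Su.
have lam_inj : injective lambda.
  by move=> i j ij; case: (ltngtP i j) => [/lamlt|/lamlt|/val_inj//];
    rewrite ij ltxx.
split.
  exists (fun i => dot (u i) (Q *m u i)).
  have Qu := commute_simple_spectrum uON lam_inj Su QS.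
  by split=> // i; apply: orthogonal_eigenvalue hQ _ (Qu i); rewrite uON eqxx.
move=> eps epsP S P_S V_S.
have epsE := sum_sign_outer uON epsP.
split=> //; first exact: orthonormal_diagE.
move=> /(orthonormal_diagE uON) ->; split; first exact: epsE.
rewrite epsE /reflection; congr (2 *: _ - _).
exact: is_orthproj_uniq (is_orthproj_sum_outer uON _) (orthprojP _).
Qed.
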